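(* Let $(\mathcal D,\mathcal I,i^\star)$ be an identification task and $H:\mathcal D\to\mathbb R^+$ an arbitrary function. For any consistent algorithm family $\mathcal A$, for all $\mu\in\mathcal D$ and all sets $D(\mu)\subseteq\mathrm{Alt}(\mu)$, $$\Big(\sup_{\lambda\in D(\mu)}R_{H,\infty}(\mathcal A,\lambda)\Big)^{-1}\le\max_{\omega\in\triangle_K}\inf_{\lambda\in D(\mu)}H(\lambda)\sum_{k=1}^K\omega_k\,\mathrm{KL}(\mu_k,\lambda_k).$$ Furthermore, $$\Big(\sup_{\lambda\in\mathcal D}R_{H,\infty}(\mathcal A,\lambda)\Big)^{-1}\le\inf_{\mu\in\mathcal D}\max_{\omega\in\triangle_K}\inf_{\lambda\in\mathrm{Alt}(\mu)}H(\lambda)\sum_{k=1}^K\omega_k\,\mathrm{KL}(\mu_k,\lambda_k).$$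
   Context: Setting (fixed budget bandit identification). There are $K\ge 1$ arms. For each arm $k\in[K]=\{1,\dots,K\}$ a one-parameter canonical exponential family of real distributions is fixed; its members are identified with their means, which range over an open interval $\mathcal M_k$. For $x,y\in\mathcal M_k$, $\mathrm{KL}(x,y)$ is the Kullback-Leibler divergence from the member with mean $x$ to the member with mean $y$. A bandit problem is identified with its mean vector $\mu\in\mathcal M_1\times\dots\times\mathcal M_K$. $\triangle_K$ is the probability simplex in $\mathbb R^K$. An identification task $(\mathcal D,\mathcal I,i^\star)$ consists of a finite answer set $\mathcal I$, a set $\mathcal D\subseteq\mathcal M_1\times\dots\times\mathcal M_K$, and a function $i^\star:\mathcal D\to\mathcal I$ such that, with $\mathcal D_i=\{\mu\in\mathcal D: i^\star(\mu)=i\}$, each $\mathcal D_i$ is open and equals the interior of its closure, and $\bigcup_{i}\mathrm{cl}(\mathcal D_i)\supseteq\mathcal M_1\times\dots\times\mathcal M_K$. $\mathrm{Alt}(\mu)=\{\lambda\in\mathcal D: i^\star(\lambda)\ne i^\star(\mu)\}$. An algorithm with horizon $T$: at each time $t=1,\dots,T$ it chooses an arm $k_t$ based on the previous observations and observes an independent sample from the distribution of arm $k_t$; after time $T$ it returns an answer $\hat i_T\in\mathcal I$ based on the observations. The error probability on problem $\mu$ is $p_{\mu,T}(\mathcal A)=\mathbb P_{\mu,\mathcal A}(\hat i_T\ne i^\star(\mu))$. An algorithm family is a sequence $\mathcal A=(\mathcal A_T)_{T\ge1}$ of algorithms, one for each horizon $T$, with $p_{\mu,T}(\mathcal A):=p_{\mu,T}(\mathcal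 A_T)$. It is consistent if $\lim_{T\to\infty}p_{\mu,T}(\mathcal A)=0$ for all $\mu\in\mathcal D$. Difficulty ratio: $R_{H,T}(\mathcal A,\mu)=\dfrac{T}{H(\mu)\log(1/p_{\mu,T}(\mathcal A))}\in[0,\infty]$, i.e. $R_{H,T}(\mathcal A,\mu)^{-1}=H(\mu)\log(1/p_{\mu,T}(\mathcal A))/T$, and $R_{H,\infty}(\mathcal A,\mu)=\limsup_{T\to\infty}R_{H,T}(\mathcal A,\mu)$. Conventions: $\log(1/0)=\infty$, $0\cdot\infty=0$, $1/0=\infty$, $1/\infty=0$, $\inf\emptyset=+\infty$, and a supremum of ratios over the empty set is $0$. *)

(* Defs.v *)
From HB Require Import structures.
From mathcomp Require Import all_boot all_order all_algebra.
From mathcomp Require Import all_classical all_reals all_analysis.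
From mathcomp Require Import measurable_realfun.

Set Implicit Arguments.
Unset Strict Implicit.
Unset Printing Implicit Defensive.

Import Order.TTheory GRing.Theory Num.Theory.
Import numFieldNormedType.Exports.

Local Open Scope classical_set_scope.
Local Open Scope ring_scope.
Local Open Scope ereal_scope.
Local Open Scope charge_scope.

Definition KL d (X : measurableType d) (R : realType)
    (P Q : probability X R) : \bar R :=
  if `[< P `<< Q >] then
    \int[P]_x lne (('d (charge_of_finite_measure P) '/d Q) x)
  else +oo.

(** One-parameter canonical exponential families, indexed by their means.
    The member with mean [x] has density [exp (theta y - b theta)] with respect
    to [ef_base], where [theta = ef_natural x] and [b = ef_logpart].
    Outside [ef_means] the fields [ef_natural] and [ef_law] are unconstrained. *)

Record exp_family (R : realType) := ExpFamily {
  ef_means : set R ;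
  ef_base : {sigma_finite_measure set (measurableTypeR R) -> \bar R} ;
  ef_natural : R -> R ;
  ef_logpart : R -> R ;
  ef_law : R -> probability (measurableTypeR R) R ;
  ef_means_neq0 : ef_means !=set0 ;
  ef_means_open : open ef_means ;
  ef_means_itv : is_interval ef_means ;
  ef_density : forall x, ef_means x -> forall A : set (measurableTypeR R),
    measurable A ->
    ef_law x A = \int[ef_base]_(y in A)
      (expR (ef_natural x * y - ef_logpart (ef_natural x)))%:E ;
  ef_integrable : forall x, ef_means x ->
    (ef_law x).-integrable setT (fun y => y%:E) ;
  ef_mean : forall x, ef_means x -> \int[ef_law x]_y y%:E = x%:E }.

HB.instance Definition _ K := isPointed.Build 'I_K.+1 ord0.

Section ordinal_measurable.
Variable K : nat.
HB.instance Definition _ := @isMeasurable.Build default_measure_display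
  'I_K.+1 discrete_measurable discrete_measurable0
  discrete_measurableC discrete_measurableU.
End ordinal_measurable.

(** A history lists (arm, reward) pairs, the most recent one first. *)
Notation history R K t := (t.-tuple ('I_K.+1 * measurableTypeR R)%type).

(** Decisions may be randomized: [rule_prob h i] is the conditional probability
    of deciding [i] given the observations [h]. *)

Record random_rule (R : realType) d (X : measurableType d) (I : finType) :=
  RandomRule {
    rule_prob :> X -> I -> R ;
    rule_prob_ge0 : forall h i, (0 <= rule_prob h i)%R ;
    rule_prob_sum1 : forall h, (\sum_i rule_prob h i = 1)%R ;
    rule_prob_measurable : forall i, measurable_fun setT (rule_prob ^~ i) }.

(** [sampling t] is used at time [t.+1], for [t < T] only. *)
Record algorithm (R : realType) (K : nat) (I : finType) (T : nat) := Algorithm {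
  sampling : forall t, random_rule R (history R K t) 'I_K.+1 ;
  answer : random_rule R (history R K T) I }.

Section mbind.
Context d d' (X : measurableType d) (Y : measurableType d') (R : realType).
Variables (P : probability X R) (k : R.-pker X ~> Y).

Definition mbind (A : set Y) : \bar R := \int[P]_x k x A.

Let mbind0 : mbind set0 = 0.
Proof. by rewrite /mbind integral0_eq. Qed.

Let mbind_ge0 A : 0 <= mbind A.
Proof. by rewrite /mbind integral_ge0. Qed.

Let mbind_sigma_additive : semi_sigma_additive mbind.
Proof.
move=> A mA tA mUA; rewrite [X in _ --> X](_ : _ =
    \int[P]_x (\sum_(0 <= i <oo) k x (A i))); last first.
  by apply: eq_integral => x _; apply/esym/cvg_lim => //;
    exact: measure_sigma_additive.
rewrite [X in X @ _](_ : _ =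
    (fun n => \int[P]_x \sum_(0 <= i < n) k x (A i))); last first.
  apply/funext => n; rewrite -ge0_integral_sum// => i.
  exact: measurable_kernel.
apply: cvg_monotone_convergence => //.
- by move=> n; apply: emeasurable_sum => i; exact: measurable_kernel.
- by move=> n x _; rewrite sume_ge0.
- by move=> x _ m n mn; exact: ereal_nondecreasing_series.
Qed.

HB.instance Definition _ := isMeasure.Build _ _ _ mbind
  mbind0 mbind_ge0 mbind_sigma_additive.

Let mbind_setT : mbind setT = 1.
Proof.
rewrite /mbind (eq_integral (cst 1)); last by move=> x _; rewrite prob_kernel.
by rewrite integral_cst//= mul1e probability_setT.
Qed.

HB.instance Definition _ := Measure_isProbability.Build _ _ _ mbind mbind_setT.

End mbind.

Definition extend (R : realType) (K t : nat) (h : history R K t)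
    (k : 'I_K.+1) (x : measurableTypeR R) : history R K t.+1 :=
  [tuple of (k, x) :: h].

Section step.
Context (R : realType) (K t : nat).
Variables (nu : 'I_K.+1 -> probability (measurableTypeR R) R)
  (pi : random_rule R (history R K t) 'I_K.+1).

(** The law of the history after one more round: given the history [h], the arm
    [k] is drawn with probability [pi h k] and then the reward with law [nu k]. *)
Definition step (h : history R K t) (A : set (history R K t.+1)) : \bar R :=
  \sum_(k < K.+1) (pi h k)%:E * nu k [set x | A (extend h k x)].

Let measurable_extend k : measurable_fun setT
  (fun hx : history R K t * measurableTypeR R =>
     extend hx.1 k hx.2).
Proof.
apply: (@measurable_cons _ _ _ _ (fun hx => (k, hx.2)) t fst) => //.
apply/measurable_fun_pairP; split => /=.
  exact: (measurable_cst k).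
exact: measurable_snd.
Qed.

Let measurable_sec k h (A : set (history R K t.+1)) : measurable A ->
  measurable [set x : measurableTypeR R | A (extend h k x)].
Proof.
move=> mA; have := measurable_extend k measurableT mA.
by rewrite setTI => /(measurable_xsection h); rewrite xsectionE.
Qed.

Let step0 h : step h set0 = 0.
Proof. by rewrite /step big1// => k _; rewrite measure0 mule0. Qed.

Let step_ge0 h A : 0 <= step h A.
Proof.
by apply: sume_ge0 => k _; rewrite mule_ge0// lee_fin rule_prob_ge0.
Qed.

Let step_sigma_additive h : semi_sigma_additive (step h).
Proof.
move=> A mA tA mUA.
rewrite [X in X @ _](_ : _ = (fun n => \sum_(k < K.+1) (pi h k)%:E *
    \sum_(0 <= i < n) nu k [set x | A i (extend h k x)])); last first.
  apply/funext => n; rewrite exchange_big/=; apply: eq_bigr => k _.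
  by rewrite ge0_sume_distrr.
apply: cvg_nnesum => k _.
  by apply: nearW => n; rewrite mule_ge0 ?lee_fin ?rule_prob_ge0// sume_ge0.
apply: cvgeZl => //.
rewrite [X in nu k X](_ : _ =
  \bigcup_i [set x | A i (extend h k x)]); last by [].
apply: measure_semi_sigma_additive.
- by move=> i; exact: measurable_sec.
- apply/trivIsetP => i j _ _ ij; move/trivIsetP : tA => /(_ i j Logic.I Logic.I ij).
  move=> /seteqP[A0 _]; apply/seteqP; split => // x [/= Aix Ajx].
  exact: (A0 (extend h k x)).
- by apply: bigcup_measurable => i _; exact: measurable_sec.
Qed.

HB.instance Definition _ h := isMeasure.Build _ _ _ (step h)
  (step0 h) (@step_ge0 h) (@step_sigma_additive h).

Definition step_kernel :
  history R K t -> {measure set (history R K t.+1) -> \bar R} := step.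

Let measurable_step (A : set (history R K t.+1)) : measurable A ->
  measurable_fun [set: history R K t] (step_kernel ^~ A).
Proof.
move=> mA; apply: emeasurable_sum => k; apply: emeasurable_funM.
  by apply/measurable_EFinP; exact: rule_prob_measurable.
have := measurable_extend k measurableT mA; rewrite setTI.
move=> /(measurable_fun_xsection (nu k)).
by apply: eq_measurable_fun => h _; rewrite /= xsectionE.
Qed.

HB.instance Definition _ := isKernel.Build _ _ _ _ _ step_kernel measurable_step.

Let step_setT h : step_kernel h setT = 1.
Proof.
rewrite /step_kernel/= /step.
under eq_bigr do rewrite [X in nu _ X](_ : _ = setT)// probability_setT mule1.
by rewrite sumEFin rule_prob_sum1.
Qed.

HB.instance Definition _ :=
  Kernel_isProbability.Build _ _ _ _ _ step_kernel step_setT.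

End step.

(** Law of the history after [t] rounds when arm [k] has reward law [nu k]. *)
Fixpoint history_law (R : realType) (K : nat)
    (nu : 'I_K.+1 -> probability (measurableTypeR R) R)
    (pi : forall t, random_rule R (history R K t) 'I_K.+1) (t : nat) :
    probability (history R K t) R :=
  match t with
  | 0 => dirac [tuple]
  | t.+1 => mbind (history_law nu pi t) (step_kernel nu (pi t))
  end.

Section bandit.
Context (R : realType) (K : nat) (I : finType).
Variables (F : 'I_K.+1 -> exp_family R).
Local Notation means := 'rV[R]_K.+1.
Implicit Types (mu lambda w : means) (D : set means) (istar : means -> I)
  (H : means -> R).

Definition mean_space : set means :=
  [set mu | forall k, ef_means (F k) (mu ord0 k)].

Definition arm_law mu (k : 'I_K.+1) : probability (measurableTypeR R) R :=
  ef_law (F k) (mu ord0 k).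

(** Only the values of [istar] on [D] matter. *)
Definition answer_class D istar (i : I) : set means :=
  [set mu | D mu /\ istar mu = i].

Record identification_task D istar : Prop := IdentificationTask {
  task_sub : D `<=` mean_space ;
  task_open : forall i, open (answer_class D istar i) ;
  task_regular : forall i,
    answer_class D istar i = interior (closure (answer_class D istar i)) ;
  task_cover : mean_space `<=` \bigcup_i closure (answer_class D istar i) }.

Definition Alt D istar mu : set means :=
  [set lambda | D lambda /\ istar lambda <> istar mu].

Definition error_prob istar T (a : algorithm R K I T) mu : \bar R :=
  \int[history_law (arm_law mu) (sampling a) T]_h
    (\sum_(i | i != istar mu) answer a h i)%:E.

(** The [n]-th member has horizon [n.+1]. *)
Definition algorithm_family := forall n, algorithm R K I n.+1.

Definition consistent D istar (A : algorithm_family) :=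
  forall mu, D mu -> error_prob istar (A n) mu @[n --> \oo] --> 0.

(** In [\bar R], [0^-1 = lne +oo = +oo], [+oo^-1 = 0] and [0 * +oo = 0]. *)
Definition difficulty_ratio H istar T (a : algorithm R K I T) mu : \bar R :=
  T%:R%:E / ((H mu)%:E * lne (error_prob istar a mu)^-1).

Definition difficulty_limit H istar (A : algorithm_family) mu : \bar R :=
  limn_esup (fun n => difficulty_ratio H istar (A n) mu).

(** Adding [0] makes the supremum of the nonnegative ratios over the empty set
    equal to [0] rather than [-oo]. *)
Definition worst_difficulty H istar (A : algorithm_family) D : \bar R :=
  ereal_sup (0 |` [set difficulty_limit H istar A lambda | lambda in D]).

Definition simplex : set means :=
  [set w | (forall k, (0 <= w ord0 k)%R) /\ (\sum_k w ord0 k = 1)%R].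

Definition payoff H mu D w : \bar R :=
  ereal_inf [set (H lambda)%:E * \sum_k (w ord0 k)%:E *
                   KL (arm_law mu k) (arm_law lambda k) | lambda in D].

Definition is_max_payoff H mu D w :=
  simplex w /\ forall w', simplex w' -> payoff H mu D w' <= payoff H mu D w.

(** The maximum over the simplex whenever [is_max_payoff] has a solution. *)
Definition max_payoff H mu D : \bar R :=
  ereal_sup [set payoff H mu D w | w in simplex].

End bandit.

(* Main.v *)
Require Import Defs.
From mathcomp Require Import all_boot all_order all_algebra.
From mathcomp Require Import all_classical all_reals all_analysis.
From mathcomp Require Import measurable_realfun.
From mathcomp Require Import ring lra.
Import Order.TTheory GRing.Theory Num.Theory.
Import numFieldNormedType.Exports.

Set Implicit Arguments.
Unset Strict Implicit.
Unset Printing Implicit Defensive.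

Local Open Scope classical_set_scope.
Local Open Scope ring_scope.
Local Open Scope ereal_scope.

(** Let [L] be the sum over the rounds of the log-likelihood ratios between the
    reward laws under [mu] and [lambda]. The law of the history under [lambda]
    has density [exp (- L)] with respect to the law under [mu], and the mean of
    [L] under [mu] is [G = \sum_k E_mu[N_k] * KL(mu_k, lambda_k)], where [N_k] is
    the number of plays of arm [k]. A Donsker-Varadhan inequality then bounds
    the error probability on [lambda], an alternative to [mu], from below by
    [exp (- (G + 1) / (1 - p_mu))]. The play frequencies [E_mu[N_k] / T] do not
    depend on [lambda] and lie in the simplex, which is compact: one of their
    cluster points works for all [lambda] at once. Along a maximizing sequence
    the same compactness argument shows that the maximum is attained. *)

(** * Integration lemmas *)

Lemma null_dominates_density d (T : measurableType d) (R : realType)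
    (P : probability T R) (m : {measure set T -> \bar R}) (p : T -> \bar R) :
    measurable_fun setT p ->
  (forall A, measurable A -> P A = \int[m]_(x in A) p x) -> P `<< m.
Proof.
move=> mp Pp; apply/null_content_dominatesP => A mA mA0.
by rewrite Pp// null_set_integral//; exact: measurable_funTS.
Qed.

(** Change of variables is known for the Radon-Nikodym derivative of [P]. On every measurable set
    [p] has the same integral as this derivative, so the two agree almost everywhere. *)
Lemma ge0_integral_density d (T : measurableType d) (R : realType)
    (P : probability T R) (m : {sigma_finite_measure set T -> \bar R})
    (p : T -> \bar R) :
    measurable_fun setT p -> (forall x, 0 <= p x) ->
    (forall A, measurable A -> P A = \int[m]_(x in A) p x) ->
  forall (E : set T) (f : T -> \bar R), measurable E -> (forall x, 0 <= f x) ->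
    measurable_fun setT f ->
  \int[P]_(x in E) f x = \int[m]_(x in E) (f x * p x).
Proof.
move=> mp p0 Pp E f mE f0 mf.
have Pm : P `<< m := null_dominates_density mp Pp.
rewrite -(Radon_Nikodym_SigmaFinite.change_of_variables Pm)//; last first.
  exact: measurable_funTS.
have mRN := measurable_int _ (Radon_Nikodym_SigmaFinite.f_integrable Pm).
apply: ae_eq_integral => //.
- by apply: measurable_funTS; exact: emeasurable_funM.
- by apply: measurable_funTS; exact: emeasurable_funM.
- apply: ae_eqe_mul2l; apply: integral_ae_eq => //.
  + apply: (integrableS measurableT) => //.
    exact: Radon_Nikodym_SigmaFinite.f_integrable.
  + exact: measurable_funTS.
  + by move=> A AE mA; rewrite -Radon_Nikodym_SigmaFinite.f_integral//; exact: Pp.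
Qed.

Lemma integral_probability_cst d (T : measurableType d) (R : realType)
    (P : probability T R) (r : \bar R) : \int[P]_x r = r.
Proof. by rewrite integral_cst//= probability_setT mule1. Qed.

Section integral_mbind.
Import HBNNSimple.

(** On indicators this is the definition of [mbind]. Linearity extends it to simple functions, then
    monotone convergence, in the inner and the outer integral, to [f]. *)
Lemma ge0_integral_mbind d d' (X : measurableType d) (Y : measurableType d')
    (R : realType) (P : probability X R) (k : R.-pker X ~> Y)
    (f : Y -> \bar R) :
    (forall y, 0 <= f y) -> measurable_fun setT f ->
  \int[mbind P k]_y f y = \int[P]_x \int[k x]_y f y.
Proof.
move=> f0 mf.
pose f_ := nnsfun_approx measurableT mf.
have mk (n : nat) : measurable_fun setT (fun x => \int[k x]_y (f_ n y)%:E).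
  apply: measurable_fun_integral_kernel.
  - by move=> U mU; exact: measurable_kernel.
  - by move=> z; rewrite lee_fin.
  - exact/measurable_EFinP.
have f_nd y : {homo (fun n => (f_ n y)%:E) : a b / (a <= b)%N >-> a <= b}.
  by move=> a b ab; rewrite lee_fin; exact/lefP/nd_nnsfun_approx.
have simple n :
    \int[mbind P k]_y (f_ n y)%:E = \int[P]_x \int[k x]_y (f_ n y)%:E.
  rewrite integralT_nnsfun sintegralE.
  under [RHS]eq_integral do rewrite integralT_nnsfun sintegralE.
  rewrite ge0_integral_fsum//.
  - apply: eq_fsbigr => r /[!inE] -[y _ <-].
    rewrite ge0_integralZl ?lee_fin//.
    exact: measurable_kernel.
  - by move=> r; apply: measurable_funeM; exact: measurable_kernel.
  - move=> r x _; have [r0|r0] := leP 0%R r; first by rewrite mule_ge0.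
    by rewrite preimage_nnfun0// measure0 mule0.
transitivity (limn (fun n => \int[mbind P k]_y (f_ n y)%:E)).
  rewrite -monotone_convergence//.
  - by apply: eq_integral => y _; apply/esym/cvg_lim => //; exact: cvg_nnsfun_approx.
  - by move=> n; exact/measurable_EFinP.
  - by move=> n y _; rewrite lee_fin.
rewrite (eq_fun simple) -monotone_convergence//.
- apply: eq_integral => x _; rewrite -monotone_convergence//.
  + by apply: eq_integral => y _; apply/cvg_lim => //; exact: cvg_nnsfun_approx.
  + by move=> n; exact/measurable_EFinP.
  + by move=> n y _; rewrite lee_fin.
- by move=> n x _; apply: integral_ge0 => y _; rewrite lee_fin.
- move=> x _ a b ab; apply: ge0_le_integral => //.
  + by move=> y _; rewrite lee_fin.
  + exact/measurable_EFinP.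
  + exact/measurable_EFinP.
  + by move=> y _; exact: f_nd.
Qed.

End integral_mbind.

Section step_integral.
Context (R : realType) (K t : nat).
Variables (nu : 'I_K.+1 -> probability (measurableTypeR R) R)
  (pi : random_rule R (history R K t) 'I_K.+1).

Lemma measurable_extend_pair k : measurable_fun setT
  (fun hx : history R K t * measurableTypeR R => extend hx.1 k hx.2).
Proof.
apply: (@measurable_cons _ _ _ _ (fun hx => (k, hx.2)) t fst) => //.
apply/measurable_fun_pairP; split => /=.
  exact: (measurable_cst k).
exact: measurable_snd.
Qed.

Lemma measurable_extend (h : history R K t) k : measurable_fun setT (extend h k).
Proof.
by have := measurableT_comp (measurable_extend_pair k) (pair1_measurable h).
Qed.

(** The measure [step_kernel nu pi h] is a finite sum of scaled pushforwards of the reward laws, and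
    each of these operations has its integral formula. *)
Lemma ge0_integral_step (h : history R K t) (f : history R K t.+1 -> \bar R) :
    (forall z, 0 <= f z) -> measurable_fun setT f ->
  \int[step_kernel nu pi h]_z f z =
  \sum_(k < K.+1) (pi h k)%:E * \int[nu k]_x f (extend h k x).
Proof.
move=> f0 mf.
(* The measures summed by [msum] are indexed by natural numbers, hence the [inord], which gives back
   the arm for indices below [K.+1]. *)
pose m_ n : {measure set (history R K t.+1) -> \bar R} :=
  mscale (NngNum (rule_prob_ge0 pi h (inord n)))
    (pushforward (nu (inord n)) (extend h (inord n))).
pose m := msum (m_ (fun n => measurable_extend h (inord n))) K.+1.
rewrite (eq_measure_integral m); last first.
  move=> A mA _; rewrite /step_kernel/= /step /m /msum.
  by apply: eq_bigr => k _; rewrite /m_/= inord_val.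
rewrite ge0_integral_measure_sum//; apply: eq_bigr => k _.
rewrite /m_ ge0_integral_mscale//= inord_val; congr (_ * _).
by rewrite ge0_integral_pushforward//; exact: measurable_extend.
Qed.

End step_integral.

(** * The law of the history *)

Section history_laws.
Context (R : realType) (K : nat).
Implicit Types (nu : 'I_K.+1 -> probability (measurableTypeR R) R)
  (pi : forall t, random_rule R (history R K t) 'I_K.+1)
  (c : 'I_K.+1 -> measurableTypeR R -> R).

Lemma integral_history_law0 nu pi (f : history R K 0 -> \bar R) :
  measurable_fun setT f -> \int[history_law nu pi 0]_z f z = f [tuple].
Proof.
by move=> mf; rewrite [LHS](integral_dirac _ measurableT mf) diracT mul1e.
Qed.

Lemma ge0_integral_history_lawS nu pi t (f : history R K t.+1 -> \bar R) :
    (forall z, 0 <= f z) -> measurable_fun setT f ->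
  \int[history_law nu pi t.+1]_z f z =
  \int[history_law nu pi t]_h
    \sum_(k < K.+1) (pi t h k)%:E * \int[nu k]_x f (extend h k x).
Proof.
move=> f0 mf; rewrite [LHS]/= ge0_integral_mbind//.
by apply: eq_integral => h _; rewrite ge0_integral_step.
Qed.

Lemma measurable_integral_step nu pi t (f : history R K t.+1 -> \bar R) :
    (forall z, 0 <= f z) -> measurable_fun setT f ->
  measurable_fun setT (fun h : history R K t =>
    \sum_(k < K.+1) (pi t h k)%:E * \int[nu k]_x f (extend h k x)).
Proof.
move=> f0 mf.
rewrite (_ : (fun _ => _) = fun h => \int[step_kernel nu (pi t) h]_z f z).
  apply: measurable_fun_integral_kernel => // U mU.
  exact: measurable_kernel.
by apply/funext => h; rewrite ge0_integral_step.
Qed.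

(** With the log-likelihood ratios of the arms for [c], this is the [L] of the overview. A general
    [c] is kept to allow for their positive and negative parts. *)
Definition history_sum c t (h : history R K t) : R :=
  (\sum_(z <- h) c z.1 z.2)%R.

Lemma history_sum0 c : history_sum c [tuple] = 0%R.
Proof. by rewrite /history_sum big_nil. Qed.

Lemma history_sum_extend c t (h : history R K t) k x :
  history_sum c (extend h k x) = (c k x + history_sum c h)%R.
Proof. by rewrite /history_sum big_cons. Qed.

(** There are finitely many arms, so the function is a finite sum of the [c k], each times the
    indicator of its arm. *)
Lemma measurable_arm_fun c : (forall k, measurable_fun setT (c k)) ->
  measurable_fun setT (fun z : 'I_K.+1 * measurableTypeR R => c z.1 z.2).
Proof.
move=> mc.
rewrite (_ : (fun _ => _) = fun z : 'I_K.+1 * measurableTypeR R =>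
    (\sum_(k < K.+1) (z.1 == k)%:R * c k z.2)%R); last first.
  apply/funext => z; rewrite (bigD1 z.1)//= eqxx mul1r big1 ?addr0// => k.
  by rewrite eq_sym => /negPf ->; rewrite mul0r.
apply: measurable_sum => k; apply: measurable_funM.
  have mk : measurable_fun setT (fun i : 'I_K.+1 => (i == k)%:R : R) by [].
  exact: (measurableT_comp mk measurable_fst).
exact: (measurableT_comp (mc k) measurable_snd).
Qed.

Lemma measurable_history_sum c t : (forall k, measurable_fun setT (c k)) ->
  measurable_fun setT (@history_sum c t).
Proof.
move=> mc; rewrite (_ : history_sum c (t := t) = fun h : history R K t =>
    (\sum_(i < t) c (tnth h i).1 (tnth h i).2)%R); last first.
  by apply/funext => h; rewrite /history_sum big_tuple.
apply: measurable_sum => i.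
exact: (measurableT_comp (measurable_arm_fun mc) (measurable_tnth i)).
Qed.

Lemma history_sum_ge0 c t (h : history R K t) :
  (forall k x, (0 <= c k x)%R) -> (0 <= history_sum c h)%R.
Proof. by move=> c0; apply: sumr_ge0. Qed.

(** The sampling rule is the same under both laws, so its probabilities cancel and each round
    contributes only the density of its reward. The product of these densities is
    [expR (- history_sum l h)]. *)
Lemma ge0_integral_history_change nu nu' pi
    (l : 'I_K.+1 -> measurableTypeR R -> R) :
    (forall k, measurable_fun setT (l k)) ->
    (forall k A, measurable A ->
      nu' k A = \int[nu k]_(x in A) (expR (- l k x))%:E) ->
  forall t (f : history R K t -> \bar R),
    (forall h, 0 <= f h) -> measurable_fun setT f ->
  \int[history_law nu' pi t]_h f h =
  \int[history_law nu pi t]_h (f h * (expR (- history_sum l h))%:E).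
Proof.
move=> ml nu'E; elim=> [|t IH] f f0 mf.
  rewrite !integral_history_law0// ?history_sum0 ?oppr0 ?expR0 ?mule1//.
  apply: emeasurable_funM => //; apply/measurable_EFinP.
  by apply: measurableT_comp => //; apply: measurableT_comp => //;
    exact: measurable_history_sum.
have mexp s : measurable_fun setT
    (fun h : history R K s => (expR (- history_sum l h))%:E).
  apply/measurable_EFinP; apply: measurableT_comp => //.
  by apply: measurableT_comp => //; exact: measurable_history_sum.
rewrite !ge0_integral_history_lawS//; last 2 first.
- by move=> z; rewrite mule_ge0// lee_fin expR_ge0.
- by apply: emeasurable_funM => //; exact: mexp.
have if0 (k : 'I_K.+1) (h : history R K t) :
    0 <= \int[nu' k]_x f (extend h k x) by apply: integral_ge0.
(* The induction hypothesis is used for the function of the first [t] rounds obtained by averaging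
   [f] over the last round under [nu']. *)
rewrite IH//; last 2 first.
- by move=> h; apply: sume_ge0 => k _; rewrite mule_ge0// lee_fin rule_prob_ge0.
- exact: measurable_integral_step.
apply: eq_integral => h _; rewrite ge0_sume_distrl; last first.
  by move=> k _; rewrite mule_ge0// lee_fin rule_prob_ge0.
apply: eq_bigr => k _; rewrite -muleA; congr (_ * _).
have mfk : measurable_fun setT (fun x => f (extend h k x)).
  exact: measurableT_comp mf (measurable_extend h k).
have mlk : measurable_fun setT (fun x => (expR (- l k x))%:E).
  by apply/measurable_EFinP; apply: measurableT_comp => //;
    exact: measurableT_comp.
have expl0 x : 0 <= (expR (- l k x))%:E by rewrite lee_fin expR_ge0.
rewrite (ge0_integral_density mlk expl0 (nu'E k))//.
rewrite -ge0_integralZr//.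
- apply: eq_integral => x _; rewrite history_sum_extend opprD expRD EFinM.
  by rewrite -!muleA.
- exact: emeasurable_funM.
- by move=> x _; rewrite mule_ge0// lee_fin expR_ge0.
Qed.

(** This is the mean number of plays of arm [k], expressed by the conditional probabilities of
    playing it instead of by a count over the history. *)
Definition expected_plays nu pi t k : \bar R :=
  \sum_(s < t) \int[history_law nu pi s]_h (pi s h k)%:E.

Lemma expected_playsS nu pi t k : expected_plays nu pi t.+1 k =
  expected_plays nu pi t k + \int[history_law nu pi t]_h (pi t h k)%:E.
Proof. exact: big_ord_recr. Qed.

Lemma measurable_play pi t k :
  measurable_fun setT (fun h : history R K t => (pi t h k)%:E).
Proof. by apply/measurable_EFinP; exact: rule_prob_measurable. Qed.

Lemma expected_plays_ge0 nu pi t k : 0 <= expected_plays nu pi t k.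
Proof.
apply: sume_ge0 => s _; apply: integral_ge0 => h _.
by rewrite lee_fin rule_prob_ge0.
Qed.

Lemma sum_expected_plays nu pi t :
  \sum_k expected_plays nu pi t k = t%:R%:E.
Proof.
rewrite exchange_big/= -[in RHS](card_ord t) -sum1_card natr_sum -sumEFin.
apply: eq_bigr => s _; rewrite -ge0_integral_sum//.
- under eq_integral do rewrite sumEFin rule_prob_sum1.
  exact: integral_probability_cst.
- by move=> k; exact: measurable_play.
- by move=> k h _; rewrite lee_fin rule_prob_ge0.
Qed.

Lemma expected_plays_fin_num nu pi t k : expected_plays nu pi t k \is a fin_num.
Proof.
rewrite ge0_fin_numE ?expected_plays_ge0//.
apply: (@le_lt_trans _ _ t%:R%:E); last exact: ltry.
rewrite -(sum_expected_plays nu pi) (bigD1 k)//= leeDl// sume_ge0// => i _.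
exact: expected_plays_ge0.
Qed.

(** A Wald identity: given the past, a round adds the mean of [c k] under [nu k] with weight the
    probability of playing [k]. Nonnegativity makes all exchanges of sums and integrals
    legitimate. *)
Lemma ge0_integral_history_sum nu pi c t :
    (forall k, measurable_fun setT (c k)) -> (forall k x, (0 <= c k x)%R) ->
  \int[history_law nu pi t]_h (history_sum c h)%:E =
  \sum_k expected_plays nu pi t k * \int[nu k]_x (c k x)%:E.
Proof.
move=> mc c0; elim: t => [|t IH].
  rewrite integral_history_law0; last first.
    by apply/measurable_EFinP; exact: measurable_history_sum.
  rewrite history_sum0 big1// => k _.
  by rewrite /expected_plays big_ord0 mul0e.
have mc' k : measurable_fun setT (fun x => (c k x)%:E) by exact/measurable_EFinP.
have ic0 k : 0 <= \int[nu k]_x (c k x)%:E.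
  by apply: integral_ge0 => x _; rewrite lee_fin.
rewrite ge0_integral_history_lawS; last 2 first.
- by move=> h; rewrite lee_fin history_sum_ge0.
- by apply/measurable_EFinP; exact: measurable_history_sum.
rewrite (eq_integral (fun h => \sum_k (pi t h k)%:E * \int[nu k]_x (c k x)%:E +
    (history_sum c h)%:E)); last first.
  move=> h _; have S0 : 0 <= (history_sum c h)%:E by rewrite lee_fin history_sum_ge0.
  (* The sum over past rounds is distributed among the arms with the weights [pi t h k], of total 1,
     so that the identity can be checked arm by arm. *)
  rewrite -[X in _ = _ + X]mul1e -(rule_prob_sum1 (pi t) h) -sumEFin.
  rewrite ge0_sume_distrl; last by move=> k _; rewrite lee_fin rule_prob_ge0.
  rewrite -big_split/=; apply: eq_bigr => k _; rewrite -ge0_muleDr//; congr (_ * _).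
  under eq_integral do rewrite history_sum_extend EFinD.
  rewrite ge0_integralD//; first by rewrite integral_probability_cst.
  by move=> x _; rewrite lee_fin.
have mpc k : measurable_fun setT
    (fun h : history R K t => (pi t h k)%:E * \int[nu k]_x (c k x)%:E).
  by apply: emeasurable_funM => //; exact: measurable_play.
have pc0 k (h : history R K t) : 0 <= (pi t h k)%:E * \int[nu k]_x (c k x)%:E.
  by rewrite mule_ge0// lee_fin rule_prob_ge0.
rewrite ge0_integralD//=; first last.
- by apply/measurable_EFinP; exact: measurable_history_sum.
- by move=> h _; rewrite lee_fin history_sum_ge0.
- by apply: emeasurable_sum => k.
- by move=> h _; apply: sume_ge0 => k _.
rewrite IH ge0_integral_sum//= addeC -big_split/=; apply: eq_bigr => k _.
rewrite ge0_integralZr//; last 2 first.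
- exact: measurable_play.
- by move=> h _; rewrite lee_fin rule_prob_ge0.
rewrite expected_playsS [RHS]ge0_muleDl//; first exact: expected_plays_ge0.
by apply: integral_ge0 => h _; rewrite lee_fin rule_prob_ge0.
Qed.

End history_laws.

(** * Change of measure *)

Lemma integral01_fin_num d (T : measurableType d) (R : realType)
    (P : probability T R) (f : T -> R) : measurable_fun setT f ->
  (forall x, (0 <= f x <= 1)%R) -> \int[P]_x (f x)%:E \is a fin_num.
Proof.
move=> mf f01; rewrite ge0_fin_numE; last first.
  by apply: integral_ge0 => x _; rewrite lee_fin; case/andP: (f01 x).
apply: (@le_lt_trans _ _ 1); last exact: ltry.
rewrite -[leRHS](integral_probability_cst P); apply: ge0_le_integral => //.
- by move=> x _; rewrite lee_fin; case/andP: (f01 x).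
- exact/measurable_EFinP.
- by move=> x _; rewrite lee_fin; case/andP: (f01 x).
Qed.

Lemma integral_affine d (T : measurableType d) (R : realType)
    (P : probability T R) (f : T -> R) (c : R) : measurable_fun setT f ->
    (forall x, (0 <= f x)%R) -> (0 <= c)%R ->
  \int[P]_x (1 + c * f x)%:E = 1 + c%:E * \int[P]_x (f x)%:E.
Proof.
move=> mf f0 c0; have mf' : measurable_fun setT (fun x => (f x)%:E).
  exact/measurable_EFinP.
under eq_integral do rewrite EFinD EFinM.
rewrite ge0_integralD//; last 2 first.
- by move=> x _; rewrite mule_ge0// lee_fin.
- exact: measurable_funeM.
rewrite integral_probability_cst ge0_integralZl//.
by move=> x _; rewrite lee_fin.
Qed.

Section change_of_measure.
Context (R : realType) (K : nat).
Variables (nu nu' : 'I_K.+1 -> probability (measurableTypeR R) R)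
  (pi : forall t, random_rule R (history R K t) 'I_K.+1)
  (l : 'I_K.+1 -> measurableTypeR R -> R).
Hypotheses (ml : forall k, measurable_fun setT (l k))
  (nu'E : forall k A, measurable A ->
      nu' k A = \int[nu k]_(x in A) (expR (- l k x))%:E)
  (il : forall k, (nu k).-integrable setT (EFin \o l k)).

(** The integral formulas for histories concern nonnegative functions. So [l] is split into its
    positive part [lp] and its negative part [lm], both of finite mean by [il]. *)
Let lp k x : R := Num.max (l k x) 0%R.
Let lm k x : R := Num.max (- l k x)%R 0%R.

Let mlp k : measurable_fun setT (lp k).
Proof. exact: measurable_maxr. Qed.

Let mlm k : measurable_fun setT (lm k).
Proof. by apply: measurable_maxr => //; exact: measurableT_comp. Qed.

Let lp_ge0 k x : (0 <= lp k x)%R. Proof. by rewrite le_max lexx orbT. Qed.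

Let lm_ge0 k x : (0 <= lm k x)%R. Proof. by rewrite le_max lexx orbT. Qed.

Let lE k x : (lp k x - lm k x = l k x)%R.
Proof. by rewrite /lp /lm; case: (leP (l k x) 0%R) => ?; case: leP => ?; lra. Qed.

Let lpE k : (fun x => (lp k x)%:E) = (EFin \o l k)^\+.
Proof. by apply/funext => x; rewrite funeposE EFin_max. Qed.

Let lmE k : (fun x => (lm k x)%:E) = (EFin \o l k)^\-.
Proof. by apply/funext => x; rewrite funenegE EFin_max. Qed.

Let lp_fin_num k : \int[nu k]_x (lp k x)%:E \is a fin_num.
Proof.
apply: integrable_fin_num => //; rewrite lpE.
exact: (integrable_funepos measurableT (il k)).
Qed.

Let lm_fin_num k : \int[nu k]_x (lm k x)%:E \is a fin_num.
Proof.
apply: integrable_fin_num => //; rewrite lmE.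
exact: (integrable_funeneg measurableT (il k)).
Qed.

Let history_sumE t (h : history R K t) :
  (history_sum lp h - history_sum lm h = history_sum l h)%R.
Proof. by rewrite /history_sum -sumrB; apply: eq_bigr => z _; exact: lE. Qed.

(** The Donsker-Varadhan inequality for the function [s * f], weakened to avoid logarithms: the
    logarithm of the mean of [expR (s * f)] under [nu'] is replaced by its upper bound [expR s - 1]
    times the mean of [f]. *)
Lemma history_change_of_measure t (f : history R K t -> R) (s : R) :
    measurable_fun setT f -> (forall h, (0 <= f h <= 1)%R) -> (0 <= s)%R ->
  (s * fine (\int[history_law nu pi t]_h (f h)%:E) -
   \sum_k fine (expected_plays nu pi t k) * fine (\int[nu k]_x (l k x)%:E)
   <= (expR s - 1) * fine (\int[history_law nu' pi t]_h (f h)%:E))%R.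
Proof.
move=> mf f01 s0; set alpha := fine _; set q := fine (\int[_]_h _).
have f0 h : (0 <= f h)%R by case/andP: (f01 h).
have es0 : (0 <= expR s - 1)%R by rewrite subr_ge0 -expR0 ler_expR.
have aE : \int[history_law nu pi t]_h (f h)%:E = alpha%:E.
  by rewrite fineK// integral01_fin_num.
have qE : \int[history_law nu' pi t]_h (f h)%:E = q%:E.
  by rewrite fineK// integral01_fin_num.
pose N k := fine (expected_plays nu pi t k).
pose p k := fine (\int[nu k]_x (lp k x)%:E).
pose m k := fine (\int[nu k]_x (lm k x)%:E).
have sumE (c : 'I_K.+1 -> measurableTypeR R -> R) :
    (forall k, measurable_fun setT (c k)) -> (forall k x, (0 <= c k x)%R) ->
    (forall k, \int[nu k]_x (c k x)%:E \is a fin_num) ->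
    \int[history_law nu pi t]_h (history_sum c h)%:E =
    (\sum_k N k * fine (\int[nu k]_x (c k x)%:E))%:E.
  move=> mc c0 cfin; rewrite ge0_integral_history_sum// -sumEFin.
  by apply: eq_bigr => k _; rewrite EFinM !fineK// expected_plays_fin_num.
have -> : (\sum_k fine (expected_plays nu pi t k) *
    fine (\int[nu k]_x (l k x)%:E) = \sum_k N k * p k - \sum_k N k * m k)%R.
  rewrite -sumrB; apply: eq_bigr => k _; rewrite -mulrBr; congr (_ * _)%R.
  rewrite (_ : \int[nu k]_x _ =
      \int[nu k]_x (lp k x)%:E - \int[nu k]_x (lm k x)%:E).
    by rewrite fineB.
  by rewrite lpE lmE; exact: integralE.
have maff (c : R) : measurable_fun setT (fun h => (1 + c * f h)%:E).
  by apply/measurable_EFinP; apply: measurable_funD => //; exact: measurable_funM.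
have aff0 (c : R) h : (0 <= c)%R -> 0 <= (1 + c * f h)%:E.
  by move=> c0; rewrite lee_fin addr_ge0// mulr_ge0.
have mexp : measurable_fun setT
    (fun h : history R K t => (expR (- history_sum l h))%:E).
  apply/measurable_EFinP; apply: measurableT_comp => //.
  by apply: measurableT_comp => //; exact: measurable_history_sum.
have msum (c : 'I_K.+1 -> measurableTypeR R -> R) :
    (forall k, measurable_fun setT (c k)) ->
    measurable_fun setT (fun h : history R K t => (history_sum c h)%:E).
  by move=> mc; apply/measurable_EFinP; exact: measurable_history_sum.
have sum0 (c : 'I_K.+1 -> measurableTypeR R -> R) (h : history R K t) :
    (forall k x, (0 <= c k x)%R) -> 0 <= (history_sum c h)%:E.
  by move=> c0; rewrite lee_fin history_sum_ge0.
have exp0 (h : history R K t) : 0 <= (expR (- history_sum l h))%:E.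
  by rewrite lee_fin expR_ge0.
(* The convexity inequality [1 + u <= expR u] at [s - L] and [- L], weighted by
   [f] and [1 - f]. *)
have pointwise h : (1 + s * f h)%:E + (history_sum lm h)%:E <=
    (1 + (expR s - 1) * f h)%:E * (expR (- history_sum l h))%:E +
    (history_sum lp h)%:E.
  rewrite -EFinM -!EFinD lee_fin.
  have := history_sumE h; move: (history_sum lp h) (history_sum lm h) => a b.
  move=> abE; rewrite -abE; have e1 := expR_ge1Dx (s - (a - b))%R.
  have e2 := expR_ge1Dx (- (a - b))%R.
  rewrite expRD in e1; case/andP: (f01 h) => fh0 fh1.
  have w1 := ler_wpM2l fh0 e1.
  have f1' : (0 <= 1 - f h)%R by rewrite subr_ge0.
  have w2 := ler_wpM2l f1' e2.
  nra.
(* The negative part is on the left and the positive part on the right, so every term is nonnegative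
   and can be integrated separately. *)
have : \int[history_law nu pi t]_h ((1 + s * f h)%:E + (history_sum lm h)%:E) <=
    \int[history_law nu pi t]_h ((1 + (expR s - 1) * f h)%:E *
      (expR (- history_sum l h))%:E + (history_sum lp h)%:E).
  apply: ge0_le_integral => //.
  - by move=> h _; rewrite adde_ge0 ?aff0 ?sum0.
  - by apply: emeasurable_funD => //; exact: msum.
  - by apply: emeasurable_funD; [exact: emeasurable_funM|exact: msum].
rewrite ge0_integralD//; first last.
- exact: msum.
- by move=> h _; rewrite sum0.
- by move=> h _; rewrite aff0.
rewrite ge0_integralD//; first last.
- exact: msum.
- by move=> h _; rewrite sum0.
- exact: emeasurable_funM.
- by move=> h _; rewrite mule_ge0 ?aff0.
(* The density turns the first integral on the right into an integral under [nu']. *)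
rewrite -(ge0_integral_history_change pi ml nu'E)//; last by move=> h; rewrite aff0.
rewrite !sumE// !integral_affine// aE qE -!EFinM -!EFinD lee_fin.
rewrite -/(p _) -/(m _); lra.
Qed.

End change_of_measure.

(** * Kullback-Leibler divergence in an exponential family *)

Lemma measurable_lne (R : realType) : measurable_fun setT (@lne R).
Proof.
rewrite (_ : @lne R = fun x => if x <= 0 then -oo else
    if x == +oo then +oo else (ln (fine x))%:E); last first.
  by apply/funext => -[r| |]//=; rewrite ?lee_fin ?leNye//=.
apply: measurable_fun_ifT => //; first exact: measurable_fun_lee.
apply: measurable_fun_ifT => //; first exact: measurable_fun_eqe.
by apply/measurable_EFinP; apply: measurableT_comp => //; exact: fine_measurable.
Qed.

Section KL_density.
Local Open Scope charge_scope.

(** The derivative in [KL] equals [expR (l x)] almost everywhere for [Q], hence also for [P], which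
    [Q] dominates. Its logarithm is then [l]. *)
Lemma KL_density d (X : measurableType d) (R : realType)
    (P Q : probability X R) (l : X -> R) : measurable_fun setT l ->
    (forall A, measurable A -> P A = \int[Q]_(x in A) (expR (l x))%:E) ->
  KL P Q = \int[P]_x (l x)%:E.
Proof.
move=> ml PE.
have mexp : measurable_fun setT (fun x => (expR (l x))%:E).
  by apply/measurable_EFinP; exact: measurableT_comp.
have PQ : P `<< Q := null_dominates_density mexp PE.
rewrite /KL asboolT//.
have mRN : measurable_fun setT ('d (charge_of_finite_measure P) '/d Q).
  exact: measurable_int (Radon_Nikodym_integrable _).
have RN : ae_eq Q setT ('d (charge_of_finite_measure P) '/d Q)
    (fun x => (expR (l x))%:E).
  apply: integral_ae_eq => //; first exact: Radon_Nikodym_integrable.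
  move=> A _ mA; rewrite -Radon_Nikodym_integral//; exact: PE.
apply: ae_eq_integral => //.
- exact: (measurableT_comp (@measurable_lne R) mRN).
- exact/measurable_EFinP.
- have := null_dominates_ae_eq measurableT PQ RN.
  apply: filterS => x /= /[apply] ->.
  by rewrite lne_EFin ?expR_gt0// expRK.
Qed.

End KL_density.

Section exp_family.
Context (R : realType) (F : exp_family R).
Implicit Types x y z : R.

Definition ef_llr x y z : R :=
  ((ef_natural F x - ef_natural F y) * z -
   (ef_logpart F (ef_natural F x) - ef_logpart F (ef_natural F y)))%R.

Lemma ef_llrC x y z : ef_llr x y z = (- ef_llr y x z)%R.
Proof. rewrite /ef_llr; ring. Qed.

Lemma measurable_ef_llr x y :
  measurable_fun setT (ef_llr x y : measurableTypeR R -> R).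
Proof. by apply: measurable_funB => //; exact: measurable_funM. Qed.

(** Both laws have positive densities for the same base measure, so the quotient of these is a
    density of one law for the other. *)
Lemma ef_law_change x y : ef_means F x -> ef_means F y -> forall A,
    measurable A ->
  ef_law F y A = \int[ef_law F x]_(z in A) (expR (- ef_llr x y z))%:E.
Proof.
move=> Fx Fy A mA; rewrite (ef_density Fy)//.
have mdens : measurable_fun setT (fun z : measurableTypeR R =>
    (expR (ef_natural F x * z - ef_logpart F (ef_natural F x)))%:E).
  apply/measurable_EFinP; apply: measurableT_comp => //.
  by apply: measurable_funB => //; exact: measurable_funM.
have dens0 (z : measurableTypeR R) :
    0 <= (expR (ef_natural F x * z - ef_logpart F (ef_natural F x)))%:E.
  by rewrite lee_fin expR_ge0.
rewrite (ge0_integral_density mdens dens0 (ef_density Fx))//.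
- apply: eq_integral => z _; rewrite -EFinM -expRD /ef_llr.
  by congr (expR _)%:E; ring.
- apply/measurable_EFinP; apply: measurableT_comp => //.
  by apply: measurableT_comp => //; exact: measurable_ef_llr.
Qed.

(** The log-likelihood ratio is affine in the reward, which has a first moment by
    [ef_integrable]. *)
Lemma integrable_ef_llr x y : ef_means F x ->
  (ef_law F x).-integrable setT (EFin \o ef_llr x y).
Proof.
move=> Fx.
rewrite (_ : EFin \o _ = fun z : measurableTypeR R =>
  (ef_natural F x - ef_natural F y)%:E * z%:E -
   (ef_logpart F (ef_natural F x) - ef_logpart F (ef_natural F y))%:E)//.
apply: integrableB => //.
  by apply: integrableZl => //; exact: ef_integrable.
exact: finite_measure_integrable_cst.
Qed.

Lemma KL_ef_law x y : ef_means F x -> ef_means F y ->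
  KL (ef_law F x) (ef_law F y) = \int[ef_law F x]_z (ef_llr x y z)%:E.
Proof.
move=> Fx Fy; apply: KL_density; first exact: measurable_ef_llr.
move=> A mA; rewrite (ef_law_change Fy Fx)//.
by apply: eq_integral => z _; rewrite -ef_llrC.
Qed.

Lemma KL_ef_law_fin_num x y : ef_means F x -> ef_means F y ->
  KL (ef_law F x) (ef_law F y) \is a fin_num.
Proof.
move=> Fx Fy; rewrite KL_ef_law//; apply: integrable_fin_num => //.
exact: integrable_ef_llr.
Qed.

End exp_family.

(** * The payoff on the simplex *)

Lemma limn_esup_lt (R : realType) (u : (\bar R)^nat) (x : \bar R) :
  limn_esup u < x -> \forall n \near \oo, u n < x.
Proof.
rewrite /limn_esup limf_esupE => /ereal_inf_lt[_ [V V_oo <-] supVx].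
apply: filterS V_oo => n Vn; apply: le_lt_trans supVx.
by apply: ereal_sup_ubound; exists n.
Qed.

Lemma lt_ereal_real_between (R : realType) (r : R) (x : \bar R) : r%:E < x ->
  exists2 s : R, (r < s)%R & s%:E < x.
Proof.
case: x => [x| |]//; rewrite ?lte_fin => rx.
  by exists ((r + x) / 2)%R; rewrite ?lte_fin ?midf_lt.
by exists (r + 1)%R; rewrite ?ltry// ltrDl.
Qed.

Section simplex.
Context (R : realType) (K : nat).
Implicit Types v w : 'rV[R]_K.+1.

Lemma continuous_linear_form (c : R) (b : 'I_K.+1 -> R) :
  continuous (fun v : 'rV[R]_K.+1 => (c * \sum_k v ord0 k * b k)%R).
Proof.
have cE k : continuous (fun w : 'rV[R]_K.+1 => (w ord0 k * b k)%R).
  move=> v; apply: continuousM; first exact: coord_continuous.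
  exact: cst_continuous.
move=> v; apply: continuousM; first exact: cst_continuous.
by apply: continuous_big => [|k _]; [exact: add_continuous|exact: cE].
Qed.

(** The simplex is closed in the unit cube. The factors 1 make its equation an instance of
    [continuous_linear_form]. *)
Lemma compact_simplex : compact (@simplex R K).
Proof.
rewrite (_ : @simplex R K =
    [set v : 'rV[R]_K.+1 | forall k, `[0%R, 1%R]%classic (v ord0 k)] `&`
    (fun v : 'rV[R]_K.+1 => (1 * \sum_k v ord0 k * 1)%R) @^-1` [set 1%R]).
  apply: compact_closedI; first
    exact: (@rV_compact R _ (fun=> `[0%R, 1%R]%classic)
      (fun=> @segment_compact R 0 1)).
  move/continuous_closedP : (@continuous_linear_form 1 (fun=> 1%R)); apply.
  exact: closed_eq.
have sumE v : (1 * \sum_k v ord0 k * 1 = \sum_k v ord0 k)%R.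
  by rewrite mul1r; under eq_bigr do rewrite mulr1.
apply/seteqP; split => [v [v0 v1]|v [v01] /=]; last first.
  rewrite sumE; split => // k; have := v01 k.
  by rewrite /= in_itv/= => /andP[].
split; last by rewrite /= sumE.
move=> k; rewrite /= in_itv/= v0/= -v1 (bigD1 k)//= lerDl.
by apply: sumr_ge0.
Qed.

Lemma simplex_neq0 : @simplex R K !=set0.
Proof.
exists (\row_k (k == ord0)%:R); split => [k|]; first by rewrite mxE ler0n.
by rewrite (bigD1 ord0)//= mxE eqxx big1 ?addr0// => k /negPf k0; rewrite mxE k0.
Qed.

End simplex.

Section payoff.
Context (R : realType) (K : nat) (F : 'I_K.+1 -> exp_family R).
Implicit Types (mu lambda w : 'rV[R]_K.+1) (D : set 'rV[R]_K.+1)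
  (H : 'rV[R]_K.+1 -> R).

Definition arm_KL mu lambda k : R :=
  fine (KL (arm_law F mu k) (arm_law F lambda k)).

Definition weighted_KL mu lambda w : R :=
  (\sum_k w ord0 k * arm_KL mu lambda k)%R.

Lemma payoffE H mu D w : mean_space F mu -> D `<=` mean_space F ->
  payoff F H mu D w =
  ereal_inf [set (H lambda * weighted_KL mu lambda w)%:E | lambda in D].
Proof.
move=> Fmu DF; rewrite /payoff; congr ereal_inf; apply: eq_imagel => lambda Dl.
rewrite EFinM -sumEFin; congr (_ * _); apply: eq_bigr => k _.
rewrite EFinM fineK//; apply: KL_ef_law_fin_num; first exact: Fmu.
exact: DF.
Qed.

(** A cluster point [v] of [w] is chosen before [lambda], and for each [lambda] the value is
    continuous in the weights. Comparing with real [c] below [a] also covers an infinite [a]. *)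
Lemma exists_payoff_ge H mu D (w : nat -> 'rV[R]_K.+1) (a : \bar R) :
    mean_space F mu -> D `<=` mean_space F -> (forall n, simplex (w n)) ->
    (forall lambda, D lambda -> forall c : R, c%:E < a ->
      \forall n \near \oo, (c <= H lambda * weighted_KL mu lambda (w n))%R) ->
  exists2 v, simplex v & a <= payoff F H mu D v.
Proof.
move=> Fmu DF sw wa.
have wsimplex : (w @ \oo) (@simplex R K) by exists 0%N => // n _; exact: sw.
have [v [sv cv]] := @compact_simplex R K _ (fmap_proper_filter w _) wsimplex.
exists v => //; rewrite payoffE//; apply: le_ereal_inf_tmp => _ [lambda Dl <-].
rewrite leNgt; apply/negP => /lt_ereal_real_between[c gc ca].
have /(_ v)/cvgr_lt/(_ _ gc) gv :=
  @continuous_linear_form R K (H lambda) (arm_KL mu lambda).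
(* Eventually [w] has values at least [c], while the values are below [c] near [v]. Since [v] is a
   cluster point, some [u] would satisfy both. *)
have [u [/= cu]] := cv [set u | (c <= H lambda * weighted_KL mu lambda u)%R]
  _ (wa _ Dl _ ca) gv.
by rewrite ltNge cu.
Qed.

(** As an infimum of continuous functions the payoff is upper semicontinuous, so it attains its
    supremum on a compact set. *)
Lemma exists_max_payoff H mu D : mean_space F mu -> D `<=` mean_space F ->
  exists w, is_max_payoff F H mu D w.
Proof.
move=> Fmu DF; have [v0 sv0] := @simplex_neq0 R K.
have [|u uP u_sup] :=
  @ereal_sup_seq _ [set payoff F H mu D w | w in @simplex R K].
  by apply/set0P; exists (payoff F H mu D v0); exists v0.
have /choice[w wP] : forall n, exists w, simplex w /\ payoff F H mu D w = u n.
  by move=> n; have [w sw wu] := uP n; exists w.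
have [|v sv vP] := @exists_payoff_ge H mu D w (max_payoff F H mu D) Fmu DF
  (fun n => (wP n).1).
  move=> lambda Dl c ca.
  have : \forall n \near \oo, c%:E < u n.
    by apply: (u_sup [set y | c%:E < y]); exact: open_ereal_gt'.
  apply: filterS => n; rewrite -(wP n).2 payoffE// -lee_fin => /ltW /le_trans; apply.
  by apply: ereal_inf_lbound; exists lambda.
exists v; split=> // w' sw'; apply: le_trans vP.
by apply: ereal_sup_ubound; exists w'.
Qed.

End payoff.

(** * The lower bound on the error probability *)

Section lower_bound.
Context (R : realType) (K : nat) (I : finType) (F : 'I_K.+1 -> exp_family R).
Variables (istar : 'rV[R]_K.+1 -> I) (T : nat) (a : algorithm R K I T).
Implicit Types (mu lambda : 'rV[R]_K.+1) (H : 'rV[R]_K.+1 -> R).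

Let law mu := history_law (arm_law F mu) (sampling a) T.

Let answer01 h i : (0 <= answer a h i <= 1)%R.
Proof.
rewrite rule_prob_ge0/= -(rule_prob_sum1 (answer a) h) (bigD1 i)//= lerDl.
by apply: sumr_ge0 => j _; exact: rule_prob_ge0.
Qed.

Let wrong_answerE h mu :
  (\sum_(i | i != istar mu) answer a h i = 1 - answer a h (istar mu))%R.
Proof.
rewrite -(rule_prob_sum1 (answer a) h) [in RHS](bigD1 (istar mu))//=.
by rewrite addrAC subrr add0r.
Qed.

Let measurable_answer i : measurable_fun setT (fun h => answer a h i).
Proof. exact: rule_prob_measurable. Qed.

Let measurable_wrong_answer mu :
  measurable_fun setT (fun h => (\sum_(i | i != istar mu) answer a h i)%R).
Proof. by under eq_fun do rewrite wrong_answerE; exact: measurable_funB. Qed.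

Let wrong_answer01 mu h : (0 <= \sum_(i | i != istar mu) answer a h i <= 1)%R.
Proof. by rewrite wrong_answerE; case/andP: (answer01 h (istar mu)) => *; lra. Qed.

Lemma error_prob_fin_num mu : error_prob F istar a mu \is a fin_num.
Proof. exact: integral01_fin_num. Qed.

Lemma error_probC mu :
  fine (\int[law mu]_h (answer a h (istar mu))%:E) =
  (1 - fine (error_prob F istar a mu))%R.
Proof.
apply/eqP; rewrite eq_sym subr_eq -fineD ?error_prob_fin_num ?integral01_fin_num//.
rewrite /error_prob -ge0_integralD//.
- under eq_integral do rewrite wrong_answerE -EFinD addrC subrK.
  by rewrite integral_probability_cst.
- by move=> h _; rewrite lee_fin rule_prob_ge0.
- exact/measurable_EFinP.
- by move=> h _; rewrite lee_fin; case/andP: (wrong_answer01 mu h).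
- exact/measurable_EFinP.
Qed.

Lemma error_prob_ge lambda i : i != istar lambda ->
  (fine (\int[law lambda]_h (answer a h i)%:E) <=
   fine (error_prob F istar a lambda))%R.
Proof.
move=> il; apply: fine_le; rewrite ?error_prob_fin_num ?integral01_fin_num//.
apply: ge0_le_integral => //.
- by move=> h _; rewrite lee_fin rule_prob_ge0.
- exact/measurable_EFinP.
- exact/measurable_EFinP.
- move=> h _; rewrite lee_fin (bigD1 i)//= lerDl.
  by apply: sumr_ge0 => j _; exact: rule_prob_ge0.
Qed.

Lemma error_prob_le1 mu : (fine (error_prob F istar a mu) <= 1)%R.
Proof.
rewrite -subr_ge0 -error_probC fine_ge0//; apply: integral_ge0 => h _.
by rewrite lee_fin rule_prob_ge0.
Qed.

Definition plays mu k : R :=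
  fine (expected_plays (arm_law F mu) (sampling a) T k).

Definition information mu lambda : R :=
  (\sum_k plays mu k * arm_KL F mu lambda k)%R.

(** The function [f] of the change of measure is the probability of answering [istar mu]. Its mean
    is [1 - p_mu] under [mu], and at most the error probability under [lambda], where this answer is
    wrong. *)
Lemma information_bound mu lambda (s : R) :
    mean_space F mu -> mean_space F lambda -> istar lambda <> istar mu ->
    (0 <= s)%R ->
  (s * (1 - fine (error_prob F istar a mu)) - information mu lambda <=
   (expR s - 1) * fine (error_prob F istar a lambda))%R.
Proof.
move=> Fmu Fl /eqP il s0; rewrite eq_sym in il.
have es0 : (0 <= expR s - 1)%R by rewrite subr_ge0 -expR0 ler_expR.
apply: le_trans (ler_wpM2l es0 (error_prob_ge il)); rewrite -error_probC.
rewrite (_ : information _ _ = (\sum_k plays mu k *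
    fine (\int[arm_law F mu k]_z
      (ef_llr (F k) (mu ord0 k) (lambda ord0 k) z)%:E))%R).
  apply: history_change_of_measure => //.
  - by move=> k; exact: measurable_ef_llr.
  - by move=> k A mA; exact: (ef_law_change (Fmu k) (Fl k)).
  - by move=> k; apply: integrable_ef_llr; exact: Fmu.
apply: eq_bigr => k _; rewrite /arm_KL KL_ef_law//.
Qed.

(** This is the preceding bound at [s = 0]. *)
Lemma information_ge0 mu lambda :
    mean_space F mu -> mean_space F lambda -> istar lambda <> istar mu ->
  (0 <= information mu lambda)%R.
Proof.
move=> Fmu Fl il; have := information_bound Fmu Fl il (lexx 0%R).
by rewrite expR0 subrr !mul0r sub0r oppr_le0.
Qed.

Lemma expR_le_error_prob mu lambda :
    mean_space F mu -> mean_space F lambda -> istar lambda <> istar mu ->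
    (fine (error_prob F istar a mu) < 1)%R ->
  (expR (- ((information mu lambda + 1) /
            (1 - fine (error_prob F istar a mu)))) <=
   fine (error_prob F istar a lambda))%R.
Proof.
move=> Fmu Fl il e1; set al := (1 - _)%R; have al0 : (0 < al)%R by rewrite subr_gt0.
(* With this [s] the left-hand side of [information_bound] is 1, which gives
   [1 <= (expR s - 1) * q <= expR s * q]. *)
set s := (_ / al)%R; have G0 := information_ge0 Fmu Fl il.
have s0 : (0 <= s)%R by rewrite divr_ge0 ?ltW// ltr_wpDl.
have := information_bound Fmu Fl il s0; rewrite -/al divfK ?gt_eqF//.
have : (0 <= fine (error_prob F istar a lambda))%R.
  by apply: fine_ge0; apply: integral_ge0 => h _; rewrite lee_fin;
    case/andP: (wrong_answer01 lambda h).
move: (fine (error_prob F istar a lambda)) => q q0 qs.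
rewrite expRN -[leLHS]mul1r ler_pdivrMr ?expR_gt0//; lra.
Qed.

Lemma lt_difficulty_ratio H mu lambda (c : R) :
    mean_space F mu -> mean_space F lambda -> istar lambda <> istar mu ->
    (fine (error_prob F istar a mu) < 1)%R -> (0 <= H lambda)%R -> (0 < c)%R ->
    (0 < T)%N ->
    difficulty_ratio F H istar a lambda < (c^-1)%:E ->
  (c * T%:R * (1 - fine (error_prob F istar a mu)) <=
   H lambda * (information mu lambda + 1))%R.
Proof.
move=> Fmu Fl il e1 H0 c0 T0.
have := expR_le_error_prob Fmu Fl il e1.
have al0 : (0 < 1 - fine (error_prob F istar a mu))%R by rewrite subr_gt0.
have p1 := error_prob_le1 lambda.
rewrite /difficulty_ratio -(fineK (error_prob_fin_num lambda)).
move: (fine (error_prob F istar a lambda)) p1 => p p1 eps.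
(* The exponential bound excludes [p = 0], so the logarithm in the ratio is finite. *)
have p0 : (0 < p)%R by apply: lt_le_trans eps; exact: expR_gt0.
rewrite inver gt_eqF// lne_EFin ?invr_gt0// lnV ?posrE// -EFinM inver.
(* A zero denominator, from [H lambda = 0] or [p = 1], would make the ratio [+oo], against its
   assumed bound. *)
case: ifPn => [_|z0]; first by rewrite gt0_muley ?lte_fin ?ltr0n// ltNge leey.
have lnp : (- ln p <= (information mu lambda + 1) /
    (1 - fine (error_prob F istar a mu)))%R.
  by rewrite lerNl -ler_expR lnK ?posrE.
have zpos : (0 < H lambda * - ln p)%R.
  by rewrite lt_neqAle eq_sym z0 mulr_ge0// oppr_ge0 ln_le0.
rewrite -EFinM lte_fin ltr_pdivrMr// mulrC ltr_pdivlMr// => Tz.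
rewrite -ler_pdivlMr// mulrC; apply/ltW/(lt_le_trans Tz).
by rewrite -mulrA; exact: ler_wpM2l.
Qed.

End lower_bound.

(** * Limits as the horizon tends to infinity *)

Section asymptotics.
Context (R : realType) (K : nat) (I : finType) (F : 'I_K.+1 -> exp_family R).
Variables (D : set 'rV[R]_K.+1) (istar : 'rV[R]_K.+1 -> I)
  (H : 'rV[R]_K.+1 -> R) (A : algorithm_family R K I).
Hypotheses (DF : D `<=` mean_space F) (H_ge0 : forall mu, D mu -> (0 <= H mu)%R)
  (consistentA : consistent F D istar A).

Definition play_frequency (mu : 'rV[R]_K.+1) (n : nat) : 'rV[R]_K.+1 :=
  (\row_k (plays F (A n) mu k / n.+1%:R))%R.

Lemma simplex_play_frequency mu n : simplex (play_frequency mu n).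
Proof.
split=> [k|].
  by rewrite mxE divr_ge0// fine_ge0// expected_plays_ge0.
under eq_bigr do rewrite mxE.
rewrite -mulr_suml (_ : \sum_k _ = n.+1%:R)%R ?divff ?pnatr_eq0//.
apply: EFin_inj; rewrite -sumEFin.
rewrite -(sum_expected_plays (arm_law F mu) (sampling (A n))).
by apply: eq_bigr => k _; rewrite fineK// expected_plays_fin_num.
Qed.

Lemma informationE mu lambda n : information F (A n) mu lambda =
  (n.+1%:R * weighted_KL F mu lambda (play_frequency mu n))%R.
Proof.
rewrite /weighted_KL mulr_sumr; apply: eq_bigr => k _.
by rewrite mxE mulrA mulrCA divff ?mulr1 ?pnatr_eq0.
Qed.

(** Dividing the bound at a fixed horizon by the horizon leaves two errors: one proportional to the
    error probability on [mu], which vanishes by consistency, and [H lambda / n.+1]. *)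
Lemma near_weighted_KL_ge mu lambda (r : \bar R) (c : R) :
    D mu -> D lambda -> istar lambda <> istar mu ->
    0 <= r -> difficulty_limit F H istar A lambda <= r -> c%:E < r^-1 ->
  \forall n \near \oo,
    (c <= H lambda * weighted_KL F mu lambda (play_frequency mu n))%R.
Proof.
(* The gap between [c] and [c'] will absorb the two vanishing errors. *)
move=> Dmu Dl il r0 lim_r /lt_ereal_real_between[c' cc' c'r].
have Fmu := DF Dmu; have Fl := DF Dl; have H0 := H_ge0 Dl.
have err0 : fine (error_prob F istar (A n) mu) @[n --> \oo] --> (0 : R)%R.
  exact: (fine_cvg (consistentA Dmu)).
have err1 : \forall n \near \oo, (fine (error_prob F istar (A n) mu) < 1)%R.
  exact: (cvgr_lt _ err0 _ ltr01).
have ratio_lt : (0 < c')%R -> \forall n \near \oo,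
    difficulty_ratio F H istar (A n) lambda < (c'^-1)%:E.
  move=> c'0; apply: limn_esup_lt; apply: le_lt_trans lim_r _.
  move: c'r; rewrite inve_pgt ?inE//= ?lee_fin ?ltW//.
  by rewrite inver gt_eqF.
have bound : \forall n \near \oo,
    (c' * n.+1%:R * (1 - fine (error_prob F istar (A n) mu)) <=
     H lambda * (information F (A n) mu lambda + 1))%R.
  (* For [c' <= 0] the left-hand side is nonpositive and the right-hand side nonnegative. The
     difficulty ratio matters only for [c' > 0]. *)
  have [c'0|c'0] := leP c' 0%R.
    apply: filterS err1 => n en; apply: (@le_trans _ _ 0%R).
      by rewrite -mulrA mulr_le0_ge0// mulr_ge0// subr_ge0 ltW.
    by rewrite mulr_ge0// addr_ge0//; exact: information_ge0 il.
  apply: filterS2 err1 (ratio_lt c'0) => n en rn.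
  exact: lt_difficulty_ratio rn.
have lim : (c' * (1 - fine (error_prob F istar (A n) mu)) -
    H lambda * n.+1%:R^-1)%R @[n --> \oo] --> (c' * (1 - 0) - H lambda * 0)%R.
  apply: cvgB; apply: cvgM; [exact: cvg_cst| |exact: cvg_cst|exact: cvg_harmonic].
  by apply: cvgB => //; exact: cvg_cst.
have cc'' : (c < c' * (1 - 0) - H lambda * 0)%R by rewrite mulr0 !subr0 mulr1.
apply: filterS2 (cvgr_gt _ lim _ cc'') bound => n.
rewrite informationE; set x := weighted_KL _ _ _ _; set e := fine _.
have T0 : (0 < n.+1%:R :> R)%R by rewrite ltr0n.
move=> lim_n bound_n; apply/ltW/(lt_le_trans lim_n).
rewrite lerBlDr -(ler_pM2r T0) mulrAC (le_trans bound_n)//.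
by rewrite mulrDl mulfVK ?gt_eqF// mulrDr mulr1 mulrCA mulrC.
Qed.

Lemma worst_difficulty_ge0 E : 0 <= worst_difficulty F H istar A E.
Proof. by apply: ereal_sup_ubound; left. Qed.

(** The worst difficulty over [E] serves as the same [r] for all [lambda] in [E], so a cluster point
    of the play frequencies under [mu] has the required payoff. *)
Lemma worst_difficulty_inv_le mu E : D mu -> E `<=` Alt D istar mu ->
  (worst_difficulty F H istar A E)^-1 <= max_payoff F H mu E.
Proof.
move=> Dmu EA.
have FE : E `<=` mean_space F by move=> lambda /EA[/DF].
have [|v sv] := @exists_payoff_ge _ _ F H mu E (play_frequency mu)
  (worst_difficulty F H istar A E)^-1 (DF Dmu) FE (simplex_play_frequency mu).
  move=> lambda El c; have [Dl il] := EA _ El.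
  apply: near_weighted_KL_ge => //; first exact: worst_difficulty_ge0.
  by apply: ereal_sup_ubound; right; exists lambda.
by move=> /le_trans; apply; apply: ereal_sup_ubound; exists v.
Qed.

End asymptotics.

Theorem theorem3 (R : realType) (K : nat) (F : 'I_K.+1 -> exp_family R)
    (I : finType) (D : set 'rV[R]_K.+1) (istar : 'rV[R]_K.+1 -> I)
    (H : 'rV[R]_K.+1 -> R) (A : algorithm_family R K I)
    (task : identification_task F D istar)
    (H_ge0 : forall mu, D mu -> (0 <= H mu)%R)
    (consistentA : consistent F D istar A) :
  (forall mu, D mu -> forall Dmu : set 'rV[R]_K.+1, Dmu `<=` Alt D istar mu ->
     (exists w, is_max_payoff F H mu Dmu w) /\
     (worst_difficulty F H istar A Dmu)^-1 <= max_payoff F H mu Dmu) /\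
  (worst_difficulty F H istar A D)^-1 <=
    ereal_inf [set max_payoff F H mu (Alt D istar mu) | mu in D].
Proof.
have DF := task_sub task.
have first mu Dmu : D mu -> Dmu `<=` Alt D istar mu ->
    (worst_difficulty F H istar A Dmu)^-1 <= max_payoff F H mu Dmu.
  exact: worst_difficulty_inv_le.
split=> [mu Dmu E EA|].
  split; last exact: first.
  by apply: exists_max_payoff; [exact: DF|move=> lambda /EA[/DF]].
apply: le_ereal_inf_tmp => _ [mu Dmu <-].
(* The first bound is used with all alternatives to [mu]. They lie in [D], so their worst difficulty
   is at most that over [D], and inversion reverses the order. *)
apply: le_trans (first mu _ Dmu (@subset_refl _ _)).
rewrite lee_pV2 ?inE ?worst_difficulty_ge0//.
apply: le_ereal_sup => _ [->|[lambda [Dlambda _] <-]]; first by left.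
by right; exists lambda.
Qed.
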